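(* Let $P$ be a poset with $|P|=d$ finite. Then $$\overline{\mathcal{L}(P)\,\mathcal{U}(P)}=\mathbb{C}^{P\times P}$$ (closure in the norm topology) if and only if $P$ is linearly ordered.
   Context: Matrices in $\mathbb{C}^{P\times P}$ have rows and columns indexed by the finite set $P$. For a finite poset $P$, $$\mathcal{L}(P):=\{L\in\mathbb{C}^{P\times P}\mid L_{xy}=0\text{ unless }y\le x\},\qquad \mathcal{U}(P):=\{U\in\mathbb{C}^{P\times P}\mid U_{xy}=0\text{ unless }x\le y\},$$ and $\mathcal{L}(P)\,\mathcal{U}(P)=\{LU\mid L\in\mathcal{L}(P),U\in\mathcal{U}(P)\}$. A poset is linearly ordered if any two of its elements are comparable. *)

(* Defs.v *)
From HB Require Import structures.
From mathcomp Require Import all_boot all_order all_algebra.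
From mathcomp Require Import complex.
From mathcomp Require Import all_classical reals topology normedtype.

Set Implicit Arguments.
Unset Strict Implicit.
Unset Printing Implicit Defensive.

Import Order.TTheory GRing.Theory Num.Theory.
Import numFieldNormedType.Exports.

Local Open Scope classical_set_scope.
Local Open Scope ring_scope.
Local Open Scope complex_scope.

(* R[i] has no topology of its own in the libraries; packing it as a
   numClosedFieldType lets it inherit the topology of the modulus, and lets
   matrices over it inherit the topology of the max norm. *)
Definition Cplx (R : realType) : numClosedFieldType := R[i].

(* The entry of M : 'M_#|P| at (x, y) in P x P is
   M (enum_rank x) (enum_rank y). The bijection enum_rank : P -> 'I_#|P| is
   unrelated to the order of P. *)
Definition lowermx (R : realType) (disp : Order.disp_t)
    (P : finPOrderType disp) : set 'M[Cplx R]_#|P| :=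
  [set L | forall x y : P,
     ~~ (y <= x)%O -> L (enum_rank x) (enum_rank y) = 0].

Arguments lowermx R {disp} P _.

Definition uppermx (R : realType) (disp : Order.disp_t)
    (P : finPOrderType disp) : set 'M[Cplx R]_#|P| :=
  [set U | forall x y : P,
     ~~ (x <= y)%O -> U (enum_rank x) (enum_rank y) = 0].

Arguments uppermx R {disp} P _.

Definition LUset (R : realType) (disp : Order.disp_t)
    (P : finPOrderType disp) : set 'M[Cplx R]_#|P| :=
  [set L *m U | L in lowermx R P & U in uppermx R P].

Arguments LUset R {disp} P _.

(* Main.v *)
(* If x and y are incomparable, let D be the down-set of their common lower
   bounds. For M = L U, an entry of M in a row of D + {x} and a column of
   D + {y} only involves the products L_az U_zb with z in D, so this square
   submatrix of size |D| + 1 has rank at most |D|. Its determinant is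
   therefore a nonzero polynomial vanishing on L(P) U(P), hence on the closure.
   Conversely, if P is linearly ordered one may assume that it is {0, ..., d-1},
   and density follows by induction on d: after perturbing the corner entry to a
   nonzero one, eliminate the first row and column and approximate the Schur
   complement. *)
Require Import Defs.
From mathcomp Require Import all_boot all_order all_algebra.
From mathcomp Require Import all_classical reals topology normedtype.
Import Order.TTheory GRing.Theory Num.Theory.
Import numFieldNormedType.Exports.
Local Open Scope classical_set_scope.
Local Open Scope ring_scope.

Lemma is_trig_mx_mul_dense (K : numFieldType) (n : nat) (e : K) (M : 'M[K]_n) :
  0 < e -> exists L U : 'M[K]_n,
    [/\ is_trig_mx L, is_trig_mx U^T & forall i j, `|M i j - (L *m U) i j| < e].
Proof.
move=> e_gt0; elim: n M => [|n IHn] M.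
  by exists 0, 0; split=> [||[]//]; rewrite ?trmx0; apply/is_trig_mxP => -[].
rewrite -[n.+1]/(1 + n)%N in M *.
(* The pivot must be nonzero to divide by it; [e / 2] stays within [e] of a zero corner. *)
set a := M 0 0; pose a' := if a == 0 then e / 2 else a.
have a'N0 : a' != 0.
  by rewrite /a'; case: ifPn => // _; rewrite gt_eqF// divr_gt0.
have aa' : `|a - a'| < e.
  rewrite /a'; case: eqP => [->|_]; last by rewrite subrr normr0.
  rewrite sub0r normrN gtr0_norm ?divr_gt0// ltr_pdivrMr//.
  by rewrite mulr_natr mulr2n ltrDl.
have [L [U [Ltrig Utrig LU]]] :=
  IHn (drsubmx M - a'^-1 *: (dlsubmx M *m ursubmx M)).
(* The product has corner [a'] and agrees with [M] on the rest of the first row and column. The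
   remaining error is that of [L *m U] against the Schur complement for [a']. *)
exists (block_mx 1 0 (a'^-1 *: dlsubmx M) L),
       (block_mx a'%:M (ursubmx M) 0 U); split.
- by rewrite is_trig_block_mx// eqxx Ltrig mx11_is_trig.
- by rewrite tr_block_mx trmx0 is_trig_block_mx// eqxx Utrig mx11_is_trig.
rewrite mulmx_block !mul1mx !mul0mx !mulmx0 !addr0.
rewrite -scalemxAl mul_mx_scalar scalerA mulVf// scale1r -scalemxAl.
move=> i j; rewrite -{1}[M]submxK; case: (split_ordP i) => i' ->;
  case: (split_ordP j) => j' ->.
- rewrite !block_mxEul !mxE !ord1 eqxx mulr1n.
  by rewrite (_ : lshift n 0 = 0)//; exact/val_inj.
- by rewrite !block_mxEur subrr normr0.
- by rewrite !block_mxEdl subrr normr0.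
- rewrite !block_mxEdr [X in `|_ - X|]mxE opprD addrA.
  by have := LU i' j'; rewrite [X in `|X - _|]mxE [X in drsubmx M i' j' + X]mxE.
Qed.

(** The rank of [x] counts the elements strictly below [x]. If [x <= y] fails, totality gives
    [y < x], and the strict down-set of [y] is properly contained in that of [x]. *)
Lemma total_rank (disp : Order.disp_t) (P : finPOrderType disp) :
  (forall x y : P, (x >=< y)%O) ->
  exists2 r : P -> 'I_#|P|, bijective r &
    forall x y, (r x <= r y)%N -> (x <= y)%O.
Proof.
move=> tot; have rank_lt (x : P) : (#|[set z | (z < x)%O]%SET| < #|P|)%N.
  rewrite -cardsT; apply/proper_card; rewrite properT.
  by apply/negP => /eqP/setP/(_ x); rewrite !inE ltxx.
pose r x := Ordinal (rank_lt x).
have rP x y : (r x <= r y)%N -> (x <= y)%O.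
  apply: contraTT => xy; rewrite -ltnNge; apply: proper_card.
  have yx : (y < x)%O.
    by rewrite lt_neqAle; case: comparableP (tot x y) xy.
  apply/properP; split; last by exists y; rewrite !inE ?ltxx.
  by apply/fintype.subsetP => z; rewrite !inE => /lt_trans; apply.
exists r => //; apply: inj_card_bij; last by rewrite card_ord.
by move=> x y rxy; apply/le_anti; rewrite !rP// rxy.
Qed.

(** Terms of the inner sum outside the image of [h] vanish, and injectivity reindexes the others.
    This serves both to relabel along a bijection and to restrict the inner index to common lower
    bounds. *)
Lemma mxsub_mul_inj (K : pzRingType) (m n p m' n' p' : nat)
    (f : 'I_m -> 'I_m') (h : 'I_n -> 'I_n') (g : 'I_p -> 'I_p')
    (A : 'M[K]_(m', n')) (B : 'M[K]_(n', p')) :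
  injective h ->
  (forall i j k, k \notin codom h -> A (f i) k * B k (g j) = 0) ->
  mxsub f h A *m mxsub h g B = mxsub f g (A *m B).
Proof.
move=> h_inj AB0; apply/matrixP => i j; rewrite !mxE.
rewrite [RHS](bigID [in codom h])/= [X in _ + X]big1 ?addr0; last exact: AB0.
rewrite -big_uniq; last by rewrite map_inj_uniq ?enum_uniq.
by rewrite big_image; apply: eq_bigr => k _; rewrite !mxE.
Qed.

Lemma det_mulmx_lt (K : fieldType) (m n : nat) (A : 'M[K]_(m, n))
    (B : 'M[K]_(n, m)) : (n < m)%N -> \det (A *m B) = 0.
Proof.
move=> nm; apply/eqP; apply: contraTT nm; rewrite -unitfE -unitmxE -leqNgt.
by move=> /mxrank_unit <-; rewrite (leq_trans (mxrankM_maxl _ _)) ?rank_leq_col.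
Qed.

Lemma LUset_dense (R : realType) (disp : Order.disp_t)
    (P : finPOrderType disp) :
  (forall x y : P, (x >=< y)%O) -> closure (LUset R P) = [set: 'M[Cplx R]_#|P|].
Proof.
move=> /total_rank[r r_bij rP]; apply/seteqP; split => // M _ B.
move=> /nbhs_ballP[e /= e_gt0 eB].
have [t rt tr] := r_bij.
(* [s] turns an enumeration index into a rank and [s'] undoes it: [M] is factored in rank order,
   then the factors are moved back. *)
pose s := (fun i : 'I_#|P| => r (enum_val i)).
have s_bij : bijective s := bij_comp r_bij (@enum_val_bij P).
pose s' := (fun i => enum_rank (t i)).
have [L [U [/is_trig_mxP Ltrig /is_trig_mxP Utrig LU]]] :=
  @is_trig_mx_mul_dense _ _ e (mxsub s' s' M) e_gt0.
exists (mxsub s s L *m mxsub s s U); split.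
  exists (mxsub s s L) => [x y|].
    move=> xy; rewrite mxE Ltrig// /s !enum_rankK ltnNge.
    by apply: contra xy; exact: rP.
  exists (mxsub s s U) => // x y xy; rewrite mxE.
  have := Utrig (s (enum_rank y)) (s (enum_rank x)); rewrite mxE; apply.
  by rewrite /s !enum_rankK ltnNge; apply: contra xy; exact: rP.
have s_codom i : i \in codom s.
  by case: s_bij => s1 _ s1K; rewrite -(s1K i) codom_f.
rewrite mxsub_mul_inj; [|exact: bij_inj|by move=> ? ? k; rewrite s_codom].
apply: eB; split=> [//|i j]; rewrite /ball/= [X in _ - X]mxE.
by have := LU (s i) (s j); rewrite mxE /s' /s !rt !enum_valK.
Qed.

(** The Leibniz formula is a finite sum of products of coordinates. *)
Lemma continuous_det_mxsub (K : numFieldType) (m n : nat) (f g : 'I_n -> 'I_m) :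
  continuous (fun M : 'M[K]_m => \det (mxsub f g M)).
Proof.
apply: continuous_big => [|s _]; first exact: add_continuous.
move=> M; apply: (@continuousM K _ (fun=> (-1) ^+ perm.odd_perm s)); first exact: cst_continuous.
apply: continuous_big => [|i _]; first exact: mul_continuous.
move=> N; under eq_fun do rewrite mxE.
exact: coord_continuous.
Qed.

Lemma closed_det_mxsub_eq0 (K : numFieldType) (m n : nat) (f g : 'I_n -> 'I_m) :
  closed [set M : 'M[K]_m | \det (mxsub f g M) = 0].
Proof.
have cl0 : closed [set (0 : K)].
  exact/accessible_closed_set1/hausdorff_accessible/(@norm_hausdorff _ K).
by apply: (preimage_closed _ cl0) => M _; exact: continuous_det_mxsub.
Qed.

Lemma closure_LUset_total (R : realType) (disp : Order.disp_t)
    (P : finPOrderType disp) :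
  closure (LUset R P) = [set: 'M[Cplx R]_#|P|] ->
  forall x y : P, (x >=< y)%O.
Proof.
move=> clT x y; apply: contraT => ncmp_xy.
pose D := [seq z <- enum P | (z <= x)%O && (z <= y)%O].
have memD z : (z \in D) = (z <= x)%O && (z <= y)%O.
  by rewrite mem_filter mem_enum andbT.
have uniqD : uniq D by rewrite filter_uniq ?enum_uniq.
pose n := size D.
(* Index 0 stands for [x] in the rows and for [y] in the columns; the later indices list [D] in
   both. *)
pose f (i : 'I_n.+1) := enum_rank (nth x (x :: D) i).
pose g (i : 'I_n.+1) := enum_rank (nth x (y :: D) i).
have f_inj : injective f.
  move=> i j /enum_rank_inj/eqP; rewrite nth_uniq//=; first by move/eqP/val_inj.
  rewrite uniqD andbT memD lexx/=; apply: contra ncmp_xy => xy.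
  by rewrite /Order.comparable xy.
have g_inj : injective g.
  move=> i j /enum_rank_inj/eqP; rewrite nth_uniq//=; first by move/eqP/val_inj.
  rewrite uniqD andbT memD lexx andbT; apply: contra ncmp_xy => xy.
  by rewrite /Order.comparable xy orbT.
pose V := [set M : 'M[Cplx R]_#|P| | \det (mxsub f g M) = 0].
have LUV : LUset R P `<=` V.
  move=> _ [L Ltrig [U Utrig <-]]; rewrite /V /mkset.
  pose h (k : 'I_n) := enum_rank (nth x D k).
  have h_inj : injective h.
    by move=> k l /enum_rank_inj/eqP; rewrite nth_uniq// => /eqP/val_inj.
  rewrite -(@mxsub_mul_inj _ _ _ _ _ _ _ f h g)//; last first.
    (* A nonzero term at [z] puts [z] below both the row and the column element. Either one of these
       lies in the down-set [D], or they are [x] and [y]; in both cases [z] is in [D]. *)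
    move=> i j k kh; apply/eqP; apply: contraNT kh; rewrite mulf_eq0 negb_or.
    rewrite -(enum_valK k); set z := enum_val k => /andP[Lz Uz].
    have zi : (z <= nth x (x :: D) i)%O by apply: contraNT Lz => /Ltrig/eqP.
    have zj : (z <= nth x (y :: D) j)%O by apply: contraNT Uz => /Utrig/eqP.
    have : z \in D.
      have down c : c \in D -> (z <= c)%O -> z \in D.
        by rewrite !memD => /andP[cx cy] zc; rewrite !(le_trans zc).
      case: i {Lz} zi => -[|i] ilt /= zi; last by apply: down zi; rewrite mem_nth.
      case: j {Uz} zj => -[|j] jlt /= zj; last by apply: down zj; rewrite mem_nth.
      by rewrite memD zi.
    move=> zD; apply/codomP.
    by exists (Ordinal (etrans (index_mem z D) zD)); rewrite /h/= nth_index.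
  exact: (@det_mulmx_lt (Cplx R)).
(* The determinant is not identically zero: the selected submatrix of this partial permutation
   matrix is the identity. *)
pose N : 'M[Cplx R]_#|P| := \matrix_(a, b) [exists k, (f k == a) && (g k == b)]%:R.
have : V N.
  apply: (@closed_det_mxsub_eq0 (Cplx R)); apply: (closure_subset LUV).
  by rewrite clT.
rewrite /V /mkset (_ : mxsub f g N = 1%:M) ?det1.
  by move/eqP; rewrite (negbTE (oner_neq0 (Cplx R))).
apply/matrixP => i j; rewrite !mxE; congr (_%:R); congr nat_of_bool.
apply/existsP/eqP => [[k /andP[/eqP/f_inj<- /eqP/g_inj<-//]]|<-].
by exists i; rewrite !eqxx.
Qed.

Theorem lemma3 (R : realType) (disp : Order.disp_t) (P : finPOrderType disp) :
  closure (LUset R P) = [set: 'M[Cplx R]_#|P|] <->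
  (forall x y : P, (x >=< y)%O).
Proof.
split; [exact: closure_LUset_total | exact: LUset_dense].
Qed.
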